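(* Let $Q$ be the set of real quadratic irrationals that are not noble numbers. Then $\mathbf J_{\mathbb R}$ restricts to an involution $Q\to Q$ (that is, $\mathbf J_{\mathbb R}(Q)\subseteq Q$ and $\mathbf J_{\mathbb R}(\mathbf J_{\mathbb R}(x))=x$ for $x\in Q$), and it respects the $\mathrm{PGL}_2(\mathbb Z)$-orbits: for $x,y\in Q$, if $x$ and $y$ lie in the same $\mathrm{PGL}_2(\mathbb Z)$-orbit then so do $\mathbf J_{\mathbb R}(x)$ and $\mathbf J_{\mathbb R}(y)$.
   Context: Write $\widehat{\mathbb R}=\mathbb R\cup\{\infty\}$. $\mathrm{PGL}_2(\mathbb Z)$ (integral $2\times 2$ matrices of determinant $\pm1$ modulo $\pm I$) acts on $\widehat{\mathbb R}$ by Möbius maps. Definition of $\mathbf J_{\mathbb R}$: An infinite binary string $a\in\{0,1\}^\omega$ is written $a=0^{n_0}1^{n_1}0^{n_2}1^{n_3}\cdots$ with $n_0\ge 0$ and $n_i\ge 1$ for $i\ge1$; if $a$ is eventually constant the list of exponents is finite and its last entry is $\infty$. Put $\kappa(a)=[n_0,n_1,n_2,\dots]=n_0+\cfrac1{n_1+\cfrac1{n_2+\cdots}}\in[0,\infty]$, with $1/\infty=0$ and $[\infty]=\infty$. This is a bijection from not-eventually-constant strings to positive irrationals. Let $\phi=(01)^\omega=0101\dots$, $\phi^*=(10)^\omega=1010\dots$, and let $\oplus$ be term-wise exclusive or. The map $\mathbf J_{\mathbb R}:\mathbb R\setminus\mathbb Q\to\widehat{\mathbb R}$ is: if $x>0$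 is irrational and $x=\kappa(a)$, then $\mathbf J_{\mathbb R}(x)=\kappa(a\oplus\phi)$; if $x<0$ is irrational and $-1/x=\kappa(a)$, then $\mathbf J_{\mathbb R}(x)=-1/\kappa(a\oplus\phi^* )$ (with $1/0=\infty$, $1/\infty=0$). Noble numbers are the elements of the $\mathrm{PGL}_2(\mathbb Z)$-orbit of the golden section $\Phi=(1+\sqrt5)/2$. *)

(* Defs.v *)
From mathcomp Require Import all_boot all_order all_algebra.
From mathcomp Require Import all_classical all_reals all_analysis.

Set Implicit Arguments.
Unset Strict Implicit.
Unset Printing Implicit Defensive.
Import Order.TTheory GRing.Theory Num.Theory.
Import numFieldNormedType.Exports.

Local Open Scope classical_set_scope.
Local Open Scope ring_scope.

(* R \cup {oo}; [None] is the point oo. *)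
Notation Rhat R := (one_point_compactification R).

Definition mobius (R : realType) (M : 'M[int]_2) (u : Rhat R) : Rhat R :=
  let a := (M 0 0)%:~R : R in let b := (M 0 1)%:~R : R in
  let c := (M 1 0)%:~R : R in let d := (M 1 1)%:~R : R in
  match u with
  | Some x => if c * x + d == 0 then None else Some ((a * x + b) / (c * x + d))
  | None => if c == 0 then None else Some (a / c)
  end.

(* M and -M induce the same map, so the orbits of PGL_2(Z) are those of the
   integral matrices of determinant 1 or -1. *)
Definition same_orbit (R : realType) (u v : Rhat R) : Prop :=
  exists2 M : 'M[int]_2, \det M = 1 \/ \det M = -1 & v = mobius M u.

Definition bstring := nat -> bool.

(* Length of the maximal initial block of [b]'s in [a]; [None] if infinite. *)
Definition run_length (b : bool) (a : bstring) : option nat :=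
  match pselect (exists k, a k != b) with
  | left ex_k => Some (ex_minn ex_k)
  | right _ => None
  end.

(* The first [m] of the exponents n_0, n_1, ... of a = b^n_0 (~~b)^n_1 b^n_2 ...
   (all of them when the list of exponents is finite with at most [m] entries,
   the last one then being +oo). *)
Fixpoint exponents (R : realType) (b : bool) (a : bstring) (m : nat) :
    seq (\bar R) :=
  if m is m'.+1 then
    if run_length b a is Some n
    then n%:R%:E :: exponents R (~~ b) (fun k => a (n + k)%N) m'
    else [:: +oo%E]
  else [::].

(* The finite continued fraction [n_0, ..., n_k]. The inverse on \bar R
   satisfies 0^-1 = +oo and (+oo)^-1 = 0, so that starting from +oo gives
   [n_k] = n_k + 1/oo = n_k. *)
Definition cfrac (R : realType) (s : seq (\bar R)) : \bar R :=
  foldr (fun n v => (n + v^-1)%E) +oo%E s.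

(* The sequence of convergents is eventually constant when [a] is eventually
   constant. *)
Definition kappa (R : realType) (a : bstring) : \bar R :=
  limn (fun m => cfrac (exponents R false a m.+1)).

Definition sxor (a b : bstring) : bstring := fun k => a k (+) b k.
Definition phi : bstring := fun k => odd k.
Definition phi_star : bstring := fun k => ~~ odd k.

(* Both +oo and -oo (the latter being - 1/0) go to the single point oo. *)
Definition to_Rhat (R : realType) (u : \bar R) : Rhat R :=
  if u is r%:E%E then Some r else None.

(* The string [a] with kappa a = x, unique for x a positive irrational. *)
Definition kappa_inv (R : realType) (x : R) : bstring :=
  xget (fun=> false) [set a : bstring | kappa R a = x%:E].

(* Meaningful only at irrational [x]. *)
Definition JR (R : realType) (x : R) : Rhat R :=
  if 0 < x then to_Rhat (kappa R (sxor (kappa_inv x) phi))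
  else to_Rhat (- (kappa R (sxor (kappa_inv (- x^-1)) phi_star))^-1)%E.

Definition quadratic_irrational (R : realType) (x : R) : Prop :=
  irrational x /\
  exists a b c : int, a != 0 /\ a%:~R * x ^+ 2 + b%:~R * x + c%:~R = 0.

Definition golden (R : realType) : R := (1 + Num.sqrt 5) / 2.

Definition noble (R : realType) (x : R) : Prop :=
  same_orbit (Some (golden R) : Rhat R) (Some x).

Definition Qset (R : realType) : set R :=
  [set x | quadratic_irrational x /\ ~ noble x].

(* Main.v *)
Require Import Defs.
From mathcomp Require Import all_boot all_order all_algebra.
From mathcomp Require Import all_classical all_reals all_analysis.
From mathcomp Require Import ring lra zify.

(** Write [S] for the left shift of strings and [~a] for the complement of [a].
   The value [kappa] obeys two rules, for every string [a]:
<<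
     kappa a = 1 + kappa (S a)  if a begins with 0,
     kappa (~a) = 1 / kappa a.
>>
   They make [kappa] a coding of the positive irrationals by the oscillating
   strings, those in which both letters occur infinitely often. The letters of
   the code of [x] are the comparisons with 1 in the slow continued fraction
   algorithm, which sends [x] to [x - 1] if [x > 1] and to [x / (1 - x)] if
   [x < 1].

   Orbits. Since [~a (+) phi = ~(a (+) phi)] and
   [S (a (+) phi) = ~(S a (+) phi)], the two rules show that for [x > 0] the
   points [J (1 / x)], [J (1 + x)] and [J (- x)] all lie in the orbit of [J x];
   negative arguments follow by composing these moves. The maps [1 / x],
   [- x] and [1 + x] generate [PGL_2(Z)], by Euclid's algorithm on the first
   column of a matrix, so [J] respects orbits on all irrationals ([JR_orbit]);
   there [J x] may well be rational or infinite.

   Involution. Let [x > 0] have code [a] and put [b = a (+) phi], so that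
   [J x = kappa b]. If [b] is oscillating then [kappa b] is an irrational with
   code [b], and [b (+) phi = a] gives [J (J x) = x]. So three facts remain.

   - [b] is oscillating if [x] is not noble: otherwise [a] ends in [phi] or
     [~phi], whose values are the golden section and its inverse, and [x] lies
     in the orbit of each of its tails ([not_noble_sxor_phi]).
   - [kappa b] is quadratic: by Lagrange's theorem [a] is eventually periodic
     ([quadratic_bits_periodic]), hence so is [b], with twice the period because
     [phi] has period 2; and eventually periodic strings have quadratic values
     ([kappar_quadratic]).
   - [kappa b] is not noble: the golden section has code [phi], so [J] sends it
     to [kappa (000...) = oo]. As [J] respects orbits, it sends every noble
     number to a rational or to [oo], whereas [J (kappa b) = x]
     ([not_noble_kappar_sxor]).

   For [x < 0] one passes to [- x], with [J (- x) = - 1 / J x]. *)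

Set Implicit Arguments.
Unset Strict Implicit.
Unset Printing Implicit Defensive.
Import Order.TTheory GRing.Theory Num.Theory.
Import numFieldNormedType.Exports.

Local Open Scope classical_set_scope.
Local Open Scope ring_scope.

(** * Strings, convergents and the value of a string *)

Definition scompl (a : bstring) : bstring := fun k => ~~ a k.

Definition stail (n : nat) (a : bstring) : bstring := fun k => a (n + k)%N.

Definition oscillating (a : bstring) : Prop :=
  forall k b, exists2 j, (k <= j)%N & a j = b.

Lemma scomplK : involutive scompl.
Proof. by move=> a; apply/funext => k; rewrite /scompl negbK. Qed.

Lemma stail0 a : stail 0 a = a. Proof. by []. Qed.

Lemma stailD m n a : stail m (stail n a) = stail (n + m) a.
Proof. by apply/funext => k; rewrite /stail addnA. Qed.

Lemma oscillating_compl a : oscillating a -> oscillating (scompl a).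
Proof.
move=> aO k b; have [j kj aj] := aO k (~~ b).
by exists j => //; rewrite /scompl aj negbK.
Qed.

Lemma oscillating_tail n a : oscillating a <-> oscillating (stail n a).
Proof.
split=> aO k b.
  have [j kj aj] := aO (n + k)%N b; exists (j - n)%N; first by lia.
  by rewrite /stail subnKC//; lia.
by have [j kj aj] := aO k b; exists (n + j)%N => //; lia.
Qed.

Lemma Noscillating a :
  ~ oscillating a -> exists k b, forall j, (k <= j)%N -> a j = b.
Proof.
move=> aNO; apply: contrapT => aN; apply: aNO => k b.
apply: contrapT => kbN; apply: aN; exists k, (~~ b) => j kj.
case: (a j =P ~~ b) => // ajb; exfalso; apply: kbN; exists j => //.
by move: ajb; case: (a j); case: (b).
Qed.

Section RunLength.
Implicit Types (a : bstring) (b : bool).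

Lemma run_length_Some b a n :
  (forall k, (k < n)%N -> a k = b) -> a n = ~~ b -> run_length b a = Some n.
Proof.
move=> ltn an; rewrite /run_length; case: pselect => [ex_k|[]]; last first.
  by exists n; rewrite an; case: (b).
case: ex_minnP => m am mmin; congr Some; apply/eqP.
rewrite eqn_leq mmin ?an; last by case: (b).
by rewrite leqNgt; apply/negP => /ltn E; rewrite E eqxx in am.
Qed.

Lemma run_length_None b a : (forall k, a k = b) -> run_length b a = None.
Proof.
move=> ab; rewrite /run_length; case: pselect => // -[k ak].
by exfalso; move: ak; rewrite ab eqxx.
Qed.

Variant run_spec b a : option nat -> Prop :=
| RunFinite n of (forall k, (k < n)%N -> a k = b) & a n = ~~ b :
    run_spec b a (Some n)
| RunInfinite of (forall k, a k = b) : run_spec b a None.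

Lemma run_lengthP b a : run_spec b a (run_length b a).
Proof.
have [[k ak]|/forallNP ab] := pselect (exists k, a k != b); last first.
  have {}ab k : a k = b by apply/eqP/negbNE/negP/ab.
  by rewrite run_length_None//; constructor.
have ex_k : exists k, a k != b by exists k.
case: (ex_minnP ex_k) => n an nmin.
have ltn k' : (k' < n)%N -> a k' = b.
  move=> k'n; apply/eqP/negbNE; apply/negP => /nmin; lia.
have {}an : a n = ~~ b by move: an; case: (a n) => /=; case: (b).
by rewrite (run_length_Some ltn an); constructor.
Qed.

Lemma run_length_compl b a : run_length (~~ b) (scompl a) = run_length b a.
Proof.
case: (run_lengthP b a) => [n ltn an|ab].
  by apply: run_length_Some => [k /ltn|]; rewrite /scompl ?an// => ->.
by apply: run_length_None => k; rewrite /scompl ab.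
Qed.

Lemma run_length_tail b a : a 0%N = b ->
  run_length b a = omap S (run_length b (stail 1 a)).
Proof.
move=> a0; case: (run_lengthP b (stail 1 a)) => [n ltn an|ab] /=.
  by apply: run_length_Some => // -[|k]//= /ltn.
by apply: run_length_None => -[|k] //; exact: ab.
Qed.

End RunLength.

Section Convergents.
Context {R : realType}.
Implicit Types (a : bstring) (b : bool) (u v : \bar R).

Definition conv m a : \bar R := cfrac (exponents R false a m).

(** Complementing a string exchanges the roles of the two letters; this removes
   the letter parameter of [exponents] from everything that follows. *)
Lemma exponents_compl b a m :
  exponents R (~~ b) (scompl a) m = exponents R b a m.
Proof.
elim: m b a => //= m IHm b a; rewrite run_length_compl.
case: (run_length b a) => [n|] //; congr (_ :: _).
exact: (IHm (~~ b) (stail n a)).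
Qed.

Lemma conv0 a : conv 0 a = +oo%E. Proof. by []. Qed.

Lemma convS m a : conv m.+1 a =
  if run_length false a is Some n
  then (n%:R%:E + (conv m (scompl (stail n a)))^-1)%E else +oo%E.
Proof.
rewrite /conv /=; case: (run_length _ _) => [n|] /=;
  last by rewrite invey adde0.
by rewrite -(exponents_compl true).
Qed.

Lemma conv_tail m a : a 0%N = false -> conv m a = (1 + conv m (stail 1 a))%E.
Proof.
move=> a0; case: m => [|m]; first by rewrite !conv0.
rewrite !convS run_length_tail//; case: (run_length _ _) => [n|] //=.
by rewrite addeA -nat1r EFinD stailD.
Qed.

(** A string beginning with 0 acquires the exponent [n_0 = 0] when complemented,
   so the order of the convergent goes up by one. *)
Lemma conv_compl m a : a 0%N = false -> conv m.+1 (scompl a) = (conv m a)^-1%E.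
Proof.
move=> a0; rewrite convS (@run_length_Some _ _ 0)//; last by rewrite /scompl a0.
by rewrite stail0 scomplK add0e.
Qed.

Lemma conv_ge0 m a : (0 <= conv m a)%E.
Proof.
elim: m a => [|m IHm] a; first by rewrite conv0.
rewrite convS; case: (run_length _ _) => // n.
by rewrite adde_ge0// ?lee_fin// inve_ge0.
Qed.

Lemma conv_ge1 m a : a 0%N = false -> (1 <= conv m a)%E.
Proof. by move=> a0; rewrite conv_tail// leeDl// conv_ge0. Qed.

Lemma inve_ge1E v : (1 <= v)%E -> exists2 r : R, 0 <= r <= 1 & (v^-1 = r%:E)%E.
Proof.
case: v => [r||]//=; last by exists 0 => //; rewrite lexx ler01.
rewrite lee_fin => r1; exists r^-1; last by rewrite inver gt_eqF//; lra.
by rewrite invr_ge0 invf_le1; lra.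
Qed.

(** The set of the values [v] of all continued fractions beginning with the
   first [j] exponents of [a]. It contains the later convergents of [a], and
   any number whose slow expansion follows [a]; as it shrinks with [j], it
   controls convergence and identifies the limit. The tails are at least 1
   because the complemented remaining string begins with 0. *)
Fixpoint expands j a v : Prop :=
  if j is j'.+1 then
    exists n v', [/\ run_length false a = Some n, (1 <= v')%E,
      expands j' (scompl (stail n a)) v' & v = (n%:R%:E + v'^-1)%E]
  else (0 <= v)%E.

(** The map [n + 1 / v] contracts distances on [1, +oo]: if [d = |r - s|] with
   [r, s >= 1] then [r s >= 1 + d], so the images are at distance at most
   [d / (1 + d)], and [d <= 1 / j] becomes [<= 1 / (j + 1)]. *)
Lemma expands_close j a u v : expands j.+1 a u -> expands j.+1 a v ->
  exists r s : R, [/\ u = r%:E, v = s%:E & `|r - s| <= j.+1%:R^-1].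
Proof.
elim: j a u v => [|j IHj] a u v [n [u' [an u1 eu ->]]] [n' [v' [an' v1 ev ->]]];
  move: an' ev; rewrite an => -[<-] {n' an} ev.
  have [r r01 ->] := inve_ge1E u1; have [s s01 ->] := inve_ge1E v1.
  exists (n%:R + r), (n%:R + s); split; rewrite ?EFinD// invr1.
  by rewrite ler_norml; lra.
have [r [s [ru sv rs]]] := IHj _ _ _ eu ev.
move: u1 v1; rewrite {}ru {}sv !lee_fin => {eu ev} r1 s1.
exists (n%:R + r^-1), (n%:R + s^-1); rewrite !inver !gt_eqF; [|lra..].
split=> //.
have -> : n%:R + r^-1 - (n%:R + s^-1) = (s - r) / (r * s).
  by field; rewrite !gt_eqF//; lra.
have rs0 : 0 < r * s by apply: mulr_gt0; lra.
have d1 : 1 + `|r - s| <= r * s.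
  have : 0 <= (r - 1) * (s - 1) by apply: mulr_ge0; lra.
  by have [_|_] := ger0P (r - s); lra.
rewrite normrM normfV (gtr0_norm rs0) distrC.
have j0 : 0 < j.+1%:R :> R by rewrite ltr0n.
have j1 : 0 < j.+2%:R :> R by rewrite ltr0n.
rewrite ler_pdivrMr// mulrC ler_pdivlMr// -nat1r.
by move: rs; rewrite -[X in _ <= X]mul1r ler_pdivlMr//; lra.
Qed.

Lemma oscillating_run b a : oscillating a -> exists2 n,
  run_length b a = Some n & (forall k, (k < n)%N -> a k = b) /\ a n = ~~ b.
Proof.
move=> aO; case: run_lengthP => [n ltn an|ab]; first by exists n.
by have [j _] := aO 0%N (~~ b); rewrite ab; case: (b).
Qed.

Lemma conv_expands j m a : oscillating a -> expands j a (conv (j + m) a).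
Proof.
elim: j a => [|j IHj] a aO /=; first exact: conv_ge0.
have [n an [_ na]] := oscillating_run false aO.
exists n, (conv (j + m) (scompl (stail n a))).
rewrite addSn convS an; split=> //.
  by apply: conv_ge1; rewrite /scompl /stail addn0 na.
by apply/IHj/oscillating_compl/(oscillating_tail n a).1.
Qed.

Lemma cvg_conv_kappa a v : conv m a @[m --> \oo] --> v -> kappa R a = v.
Proof.
move=> av; apply/cvg_lim => //.
by rewrite (cvg_shiftS (conv ^~ a)).
Qed.

Lemma exists_invS_le (e : R) : 0 < e -> exists N, N.+1%:R^-1 <= e.
Proof.
move=> e0; exists (Num.truncn e^-1); rewrite invf_ple ?posrE ?ltr0n//.
by rewrite ltW// truncnS_gt.
Qed.

Lemma expands_cvg a (x : R) : oscillating a -> (forall j, expands j a x%:E) ->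
  conv m a @[m --> \oo] --> x%:E.
Proof.
move=> aO ex; apply/fine_cvgP; split.
  exists 1%N => // -[//|m] _; have := conv_expands 1 m aO.
  by move=> /expands_close/(_ (ex 1%N))[r [s [/= -> _ _]]].
apply/cvgrPdist_le => e e0.
have [N Ne] := exists_invS_le e0.
near=> m; apply: (le_trans _ Ne).
have Nm : (N.+1 <= m)%N by near: m; exists N.+1.
have := conv_expands N.+1 (m - N.+1) aO; rewrite subnKC//.
by move=> /(expands_close (ex N.+1))[r [s [[->] E rs]]]; rewrite /= E.
Unshelve. all: by end_near. Qed.

Lemma oscillating_cvg a : oscillating a ->
  exists x : R, conv m a @[m --> \oo] --> x%:E.
Proof.
move=> aO.
have fin m : conv m.+1 a = (fine (conv m.+1 a))%:E.
  have := conv_expands 1 m aO; rewrite add1n => e1.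
  by have [r [s [-> _ _]]] := expands_close e1 e1.
have : cauchy (fine (conv m.+1 a) @[m --> \oo]).
  apply: cauchy_exP => e e0.
  have [N Ne] := exists_invS_le (divr_gt0 e0 (ltr0n R 2)).
  exists (fine (conv N.+1 a)); exists N => // m /= Nm.
  have := conv_expands N.+1 (m - N) aO; have := conv_expands N.+1 0 aO.
  rewrite !addSn subnKC// addn0 => /expands_close E /E[r [s [-> -> /= rs]]].
  by rewrite /ball/=; apply: (le_lt_trans rs); apply: (le_lt_trans Ne); lra.
move=> /cauchy_cvgP/cvg_ex[x xE]; exists x.
suff : conv m.+1 a @[m --> \oo] --> x%:E by rewrite (cvg_shiftS (conv ^~ a)).
apply: cvg_EFin xE; exists 0%N => // m _ /=.
by rewrite fin.
Qed.

(** The values of the eventually constant strings. *)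
Definition rational_or_oo v : Prop :=
  v = +oo%E \/ exists2 q : rat, 0 <= q & v = (ratr q : R)%:E.

Lemma rational_or_oo_inv v : rational_or_oo v -> rational_or_oo v^-1%E.
Proof.
case=> [->|[q q0 ->]]; first by right; exists 0; rewrite ?invey ?rmorph0.
have [->|qN0] := eqVneq q 0; first by left; rewrite rmorph0 inve0.
by right; exists q^-1; rewrite ?invr_ge0// inver fmorph_eq0 (negPf qN0) fmorphV.
Qed.

Lemma rational_or_oo_add1 v : rational_or_oo v -> rational_or_oo (1 + v)%E.
Proof.
case=> [->|[q q0 ->]]; first by left; rewrite addey.
by right; exists (1 + q); rewrite ?addr_ge0// rmorphD rmorph1.
Qed.

Lemma eventually_constant_conv a k b : (forall j, (k <= j)%N -> a j = b) ->
  exists2 v, rational_or_oo v & \forall m \near \oo, conv m a = v.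
Proof.
pose P a := exists2 v, rational_or_oo v & \forall m \near \oo, conv m a = v.
have P_compl c : c 0%N = true -> P (scompl c) -> P c.
  move=> a0 [v rv [N _ cv]]; exists v^-1%E; first exact: rational_or_oo_inv.
  exists N.+1 => // -[//|m] Nm.
  by rewrite -[c]scomplK conv_compl ?cv// /scompl a0.
have P_tail c : c 0%N = false -> P (stail 1 c) -> P c.
  move=> a0 [v rv [N _ cv]]; exists (1 + v)%E; first exact: rational_or_oo_add1.
  by exists N => // m Nm; rewrite conv_tail// cv.
have P_zero c : (forall j, c j = false) -> P c.
  move=> a0; exists +oo%E; first by left.
  by exists 0%N => // -[//|m] _; rewrite convS run_length_None.
rewrite -/(P a); elim: k a b => [|k IHk] a b ab.
  case: b ab => ab; last by apply: P_zero => j; rewrite ab.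
  by apply: P_compl; [|apply: P_zero => j]; rewrite /scompl ab.
case a0: (a 0%N).
  apply: P_compl => //; apply: P_tail; first by rewrite /scompl a0.
  by apply: (IHk _ (~~ b)) => j kj; rewrite /stail /scompl ab.
by apply: P_tail => //; apply: (IHk _ b) => j kj; rewrite /stail ab.
Qed.

Lemma Noscillating_conv a : ~ oscillating a ->
  exists2 v, rational_or_oo v & \forall m \near \oo, conv m a = v.
Proof. by move=> /Noscillating[k [b]]; exact: eventually_constant_conv. Qed.

Lemma conv_cvg_kappa a : conv m a @[m --> \oo] --> kappa R a.
Proof.
suff [v av] : exists v, conv m a @[m --> \oo] --> v.
  by rewrite (cvg_conv_kappa av).
have [/oscillating_cvg[x ax]|/Noscillating_conv[v _ av]] :=
  pselect (oscillating a).
  by exists x%:E.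
by exists v; exact: cvg_near_cst.
Qed.

Lemma kappa_ge0 a : (0 <= kappa R a)%E.
Proof.
apply: cvge_ge (conv_cvg_kappa (a := a)).
by exists 0%N => // m _; exact: conv_ge0.
Qed.

Lemma kappa_tail a : a 0%N = false -> kappa R a = (1 + kappa R (stail 1 a))%E.
Proof.
move=> a0; apply: cvg_conv_kappa.
under eq_fun do rewrite conv_tail//.
apply: cvgeD; [exact: fin_num_adde_defr|exact: cvg_cst|exact: conv_cvg_kappa].
Qed.

Definition kappar a : R := fine (kappa R a).

Lemma kapparE a : oscillating a -> kappa R a = (kappar a)%:E.
Proof.
by move=> /oscillating_cvg[x /cvg_conv_kappa ax]; rewrite /kappar ax.
Qed.

(** Comparing limits of products, instead of using continuity of the inverse,
   also excludes the value 0. *)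
Lemma kappar_compl_mul a : oscillating a -> a 0%N = false ->
  kappar (scompl a) * kappar a = 1.
Proof.
move=> aO a0.
have := conv_cvg_kappa (a := a); rewrite kapparE// => /fine_cvgP[[N _ fa] ca].
have := conv_cvg_kappa (a := scompl a).
rewrite kapparE; last exact: oscillating_compl.
rewrite -(cvg_shiftS (conv ^~ (scompl a))) => /fine_cvgP[_ cc].
apply/esym/(@cvg_unique _ (@Rhausdorff R) _ _ _ _ _ (cvgM cc ca)).
apply: cvg_near_cst; exists N => // m Nm /=.
rewrite conv_compl//; move: (fa _ Nm) (conv_ge1 m a0).
case: (conv m a) => // r _; rewrite lee_fin => r1 /=.
by rewrite inver gt_eqF ?mulVf//= ?gt_eqF//; lra.
Qed.

Lemma kappa_compl a : kappa R (scompl a) = (kappa R a)^-1%E.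
Proof.
wlog a0 : a / a 0%N = false.
  case a0: (a 0%N) => H; last exact: H.
  have E : kappa R a = (kappa R (scompl a))^-1%E.
    by rewrite -{1}[a]scomplK H// /scompl a0.
  by rewrite E inveK.
have [aO|aN] := pselect (oscillating a).
  have := kappar_compl_mul aO a0.
  rewrite !kapparE//; last exact: oscillating_compl.
  move=> ca; rewrite inver; case: eqP => [E|/eqP kN0].
    by move: ca; rewrite E mulr0 => /eqP; rewrite eq_sym oner_eq0.
  by congr EFin; apply: (mulIf kN0); rewrite ca mulVf.
have [v _ av] := Noscillating_conv aN.
rewrite (cvg_conv_kappa (cvg_near_cst _ av)); apply: cvg_conv_kappa.
rewrite -(cvg_shiftS (conv ^~ (scompl a))); apply: cvg_near_cst.
by apply: filterS av => m <-; exact: conv_compl.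
Qed.

Lemma kappar_compl a : kappar (scompl a) = (kappar a)^-1.
Proof. by rewrite /kappar kappa_compl; case: inveP => //=; rewrite invr0. Qed.

Lemma kappar_gt0 a : oscillating a -> 0 < kappar a.
Proof.
move=> aO; rewrite lt_neqAle -lee_fin -kapparE// kappa_ge0 andbT eq_sym.
apply/eqP => ka0; have : kappa R (scompl a) = +oo%E.
  by rewrite kappa_compl kapparE// ka0 inve0.
by rewrite kapparE//; exact: oscillating_compl.
Qed.

Lemma kappar_tail a : oscillating a -> a 0%N = false ->
  kappar a = 1 + kappar (stail 1 a).
Proof.
move=> aO a0; rewrite {1}/kappar kappa_tail// kapparE//.
exact: (oscillating_tail 1 a).1.
Qed.

(** The first rule transported by complementation: prefixing 1 maps [t] to
   [t / (1 + t)]. *)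
Lemma kappar_tail_true a : oscillating a -> a 0%N = true ->
  (kappar a)^-1 = 1 + (kappar (stail 1 a))^-1.
Proof.
move=> aO a0; rewrite -!kappar_compl kappar_tail//.
  exact: oscillating_compl.
by rewrite /scompl a0.
Qed.

End Convergents.

(** * The coding of positive irrationals *)

Section Irrational.
Context {R : realType}.
Implicit Types (x y : R) (a b c d : int).

(** Clearing denominators: the form in which rationality is refuted below. *)
Lemma irrationalP x :
  irrational x <-> forall p q : int, q%:~R * x = p%:~R -> q = 0.
Proof.
split=> [xI p q qx|xI [q _ qx]].
  apply/eqP; apply: contra_notT xI => q0; exists (p%:~R / q%:~R) => //.
  by rewrite fmorph_div/= !ratr_int -qx mulrC mulKf// intr_eq0.
have /(_ _)/eqP := xI (numq q) (denq q); rewrite denq_eq0 => H.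
suff : false by []; apply: H; rewrite -qx -[q in ratr q]divq_num_den.
by rewrite fmorph_div/= !ratr_int mulrC mulfVK// intr_eq0 denq_eq0.
Qed.

Lemma irrational_mobius a b c d x y : a * d - b * c != 0 ->
  y * (c%:~R * x + d%:~R) = a%:~R * x + b%:~R -> irrational x -> irrational y.
Proof.
move=> det0 yx /irrationalP xI; apply/irrationalP => p q qy.
have : (p * c - q * a)%:~R * x = (q * b - p * d)%:~R.
  rewrite !rmorphB/= !rmorphM/= -qy.
  by have := congr1 ( *%R q%:~R) yx; lra.
move=> E; have E1 := xI _ _ E.
move: E; rewrite E1 mul0r => /esym/eqP; rewrite intr_eq0 => /eqP E2.
apply/eqP; have : q * (a * d - b * c) = 0 by have -> : q * (a * d - b * c) =
    - (p * c - q * a) * d - (q * b - p * d) * c; [ring|rewrite E1 E2; ring].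
by move=> /eqP; rewrite mulf_eq0 (negPf det0) orbF.
Qed.

Lemma irrational_int x a : irrational x -> x != a%:~R.
Proof.
move=> /irrationalP xI; apply/eqP => xa.
by have := xI a 1; rewrite mul1r xa => /(_ erefl).
Qed.

Lemma irrational_neq0 x : irrational x -> x != 0.
Proof. exact: (@irrational_int x 0). Qed.

Lemma irrationalV x : irrational x -> irrational x^-1.
Proof.
move=> xI; apply: (@irrational_mobius 0 1 1 0 x) => //.
by rewrite mul1r mul0r add0r addr0 mulVf// irrational_neq0.
Qed.

Lemma irrationalN x : irrational x -> irrational (- x).
Proof.
by apply: (@irrational_mobius (-1) 0 0 1 x) => //; rewrite mulrN1z; ring.
Qed.

Lemma irrationalD x a : irrational x -> irrational (x + a%:~R).
Proof.
by apply: (@irrational_mobius 1 a 0 1 x) => //; [rewrite mulr0|ring].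
Qed.

End Irrational.

Section Coding.
Context {R : realType}.
Implicit Types (a b : bstring) (x : R).

Local Notation kappar := (@kappar R).

Lemma kappar_lt1 a : oscillating a -> (kappar a < 1) = a 0%N.
Proof.
move=> aO; have aT := (oscillating_tail 1 a).1 aO.
have kT := @kappar_gt0 R _ aT; case a0: (a 0%N); last first.
  by rewrite (kappar_tail aO a0); lra.
rewrite -[kappar a]invrK (kappar_tail_true aO a0) invf_lt1.
  by rewrite ltrDl invr_gt0.
by rewrite addr_gt0// invr_gt0.
Qed.

(** Euclid's descent: if the value is [p / q], removing one letter gives
   [(p - q) / q] or [p / (q - p)], again positive, so that [p + q] would
   decrease forever. *)
Lemma kappar_irrational a : oscillating a -> irrational (kappar a).
Proof.
have descent n : forall (p q : nat) a, (p + q <= n)%N -> oscillating a ->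
    q%:R * kappar a = p%:R -> q = 0%N.
  elim: n => [|n IHn] p q c; first by lia.
  move=> pqn cO qp; apply/eqP; rewrite -leqn0 leqNgt; apply/negP => q0.
  have cT := (oscillating_tail 1 c).1 cO.
  have k0 := @kappar_gt0 R _ cO; have kT := @kappar_gt0 R _ cT.
  have p0 : (0 < p)%N by rewrite -(ltr0n R) -qp mulr_gt0// ltr0n.
  case c0: (c 0%N).
    have E : (q%:R - p%:R) * kappar (stail 1 c) = p%:R.
      have kE : kappar (stail 1 c) = kappar c * (1 + kappar (stail 1 c)).
        rewrite -[kappar c]invrK (kappar_tail_true cO c0).
        by field; rewrite !gt_eqF//; lra.
      by have := congr1 ( *%R q%:R) kE; rewrite -qp; lra.
    have pq : (p < q)%N.
      by rewrite -(ltr_nat R) -subr_gt0 -(pmulr_lgt0 _ kT) E ltr0n.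
    have le_n : (p + (q - p) <= n)%N by lia.
    by have := IHn _ _ _ le_n cT; rewrite (natrB _ (ltnW pq)) => /(_ E); lia.
  have E : q%:R * kappar (stail 1 c) = p%:R - q%:R.
    by rewrite -qp (kappar_tail cO c0); ring.
  have pq : (q < p)%N.
    by rewrite -(ltr_nat R) -subr_gt0 -E mulr_gt0// ltr0n.
  have le_n : (p - q + q <= n)%N by lia.
  by have := IHn _ _ _ le_n cT; rewrite (natrB _ (ltnW pq)) => /(_ E); lia.
move=> aO; apply/irrationalP => p q qp; have k0 := @kappar_gt0 R _ aO.
have : `|q|%:R * kappar a = `|p|%:R.
  by rewrite !natr_absz !intr_norm -qp normrM (gtr0_norm k0).
by move=> /(descent _ _ _ _ (leqnn _) aO)/eqP; rewrite absz_eq0 => /eqP.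
Qed.

Lemma kappa_irrational_oscillating a x : kappa R a = x%:E -> irrational x ->
  oscillating a.
Proof.
move=> ax xI; apply: contrapT => /(@Noscillating_conv R)[v rv /cvg_near_cst av].
move: rv; rewrite -(cvg_conv_kappa av) ax => -[//|[q _ [qx]]].
by apply: xI; exists q.
Qed.

Lemma kappar_inj a b : oscillating a -> oscillating b ->
  kappar a = kappar b -> a = b.
Proof.
move=> aO bO ab; apply/funext => k.
elim: k a b aO bO ab => [|k IHk] a b aO bO ab.
  by rewrite -!kappar_lt1// ab.
have ab0 : a 0%N = b 0%N by rewrite -!kappar_lt1// ab.
apply: (IHk (stail 1 a) (stail 1 b)); [exact: (oscillating_tail 1 _).1..|].
case a0: (a 0%N); have b0 := a0; rewrite ab0 in b0.
  have := @kappar_tail_true R _ bO b0; rewrite -ab (kappar_tail_true aO a0).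
  by move=> /addrI/invr_inj.
by have := @kappar_tail R _ bO b0; rewrite -ab (kappar_tail aO a0) => /addrI.
Qed.

(** One step down the Stern-Brocot tree. *)
Definition slow x : R := if x < 1 then x / (1 - x) else x - 1.

Definition bits x : bstring := fun k => iter k slow x < 1.

Definition irrational_pos x := irrational x /\ 0 < x.

Lemma irrational_pos_inv x : irrational_pos x -> irrational_pos x^-1.
Proof. by case=> xI x0; split; [exact: irrationalV|rewrite invr_gt0]. Qed.

Lemma irrational_pos_slow x : irrational_pos x -> irrational_pos (slow x).
Proof.
case=> xI x0; have := irrational_int 1 xI; rewrite neq_lt /slow.
case: ltP => x1 /= => [_|x1']; last first.
  by split; [by have := @irrationalD _ x (-1) xI; rewrite mulrN1z|lra].
have x1N : 1 - x != 0 by rewrite gt_eqF//; lra.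
split; last by apply: divr_gt0; lra.
apply: (@irrational_mobius _ 1 0 (-1) 1 x) => //.
by rewrite mulN1r [- x + 1]addrC divfK// mul1r addr0.
Qed.

Lemma irrational_pos_iter k x :
  irrational_pos x -> irrational_pos (iter k slow x).
Proof. by move=> xI; elim: k => //= k; exact: irrational_pos_slow. Qed.

(** The slow algorithm commutes with inversion, which exchanges the two sides
   of 1 and hence complements the code. *)
Lemma slowV x : irrational_pos x -> slow x^-1 = (slow x)^-1.
Proof.
case=> xI x0; have := irrational_int 1 xI; rewrite neq_lt /slow.
case: ltP => x1 /= x1'.
  by rewrite invf_lt1// ltNge (ltW x1)/=; field; rewrite !gt_eqF//; lra.
by rewrite invf_lt1// x1'; field; rewrite !gt_eqF//; lra.
Qed.

Lemma bitsV x : irrational_pos x -> bits x^-1 = scompl (bits x).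
Proof.
move=> xI; apply/funext => k; rewrite /bits /scompl.
have -> : iter k slow x^-1 = (iter k slow x)^-1.
  by elim: k => //= k ->; rewrite slowV//; exact: irrational_pos_iter.
have [yI y0] := irrational_pos_iter k xI.
rewrite invf_lt1// -leNgt [in RHS]le_eqVlt eq_sym.
by rewrite (negPf (irrational_int 1 yI)).
Qed.

Lemma stail_bits k x : stail k (bits x) = bits (iter k slow x).
Proof. by apply/funext => j; rewrite /stail /bits addnC iterD. Qed.

Lemma iter_slow_trunc x i : 0 < x -> (i <= Num.truncn x)%N ->
  iter i slow x = x - i%:R.
Proof.
move=> x0; elim: i => [|i IHi] ix /=; first by rewrite subr0.
rewrite IHi 1?ltnW// /slow -natr1.
have : i.+1%:R <= x by rewrite -truncn_ge_nat// ltW.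
by rewrite -natr1; case: ltP => ?; lra.
Qed.

(** Above 1 the slow algorithm subtracts 1, so the first run of zeros counts the
   integer part. *)
Lemma bits_run x : 0 < x -> run_length false (bits x) = Some (Num.truncn x).
Proof.
move=> x0; have /andP[] := truncn_itv (ltW x0); rewrite -natr1 => xn nx.
apply: run_length_Some => [k kn|]; rewrite /bits iter_slow_trunc// 1?ltnW//.
  have : k.+1%:R <= (Num.truncn x)%:R :> R by rewrite ler_nat.
  by rewrite -natr1; lra.
by rewrite /=; lra.
Qed.

(** A 1 occurs because a run of zeros is as long as an integer part; a 0 occurs
   by the same argument for the inverse. *)
Lemma bits_oscillating x : irrational_pos x -> oscillating (bits x).
Proof.
suff T y : irrational_pos y -> exists j, bits y j = true.
  move=> xI k b; case: b.
    have [j yj] := T _ (irrational_pos_iter k xI).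
    by exists (k + j)%N; [exact: leq_addr|rewrite -stail_bits in yj].
  have [j] := T _ (irrational_pos_inv (irrational_pos_iter k xI)).
  rewrite bitsV; last exact: irrational_pos_iter.
  by rewrite -stail_bits => /negPf yj; exists (k + j)%N; [exact: leq_addr|].
move=> [_ y0]; have := bits_run y0.
by case: run_lengthP => // n _ yn _; exists n.
Qed.

Lemma bits_expands j x : irrational_pos x -> expands j (bits x) x%:E.
Proof.
elim: j x => [|j IHj] x xI /=; first by rewrite lee_fin ltW// xI.2.
set n := Num.truncn x; have E := iter_slow_trunc xI.2 (leqnn n).
have yI := irrational_pos_iter n xI; rewrite E in yI.
exists n, (x - n%:R)^-1%:E; split; first exact: (bits_run xI.2).
- rewrite lee_fin invf_ge1; last exact: yI.2.
  have /andP[_] := truncn_itv (ltW xI.2); rewrite -/n -natr1; lra.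
- rewrite stail_bits E -bitsV//.
  exact: IHj (irrational_pos_inv yI).
- by rewrite inver invr_eq0 invrK gt_eqF ?yI.2// -EFinD addrC subrK.
Qed.

Lemma kappa_bits x : irrational_pos x -> kappa R (bits x) = x%:E.
Proof.
move=> xI; apply: cvg_conv_kappa; apply: expands_cvg => [|j].
  exact: bits_oscillating.
exact: bits_expands.
Qed.

Lemma kappa_invP x : irrational_pos x -> kappa R (kappa_inv x) = x%:E.
Proof.
move=> xI; rewrite /kappa_inv; case: xgetP => [y _ //|/(_ (bits x))[]].
exact: kappa_bits.
Qed.

Lemma kappa_inv_oscillating x : irrational_pos x -> oscillating (kappa_inv x).
Proof.
by move=> xI; apply: kappa_irrational_oscillating (kappa_invP xI) xI.1.
Qed.

Lemma kappa_invE a x : irrational_pos x -> kappa R a = x%:E -> kappa_inv x = a.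
Proof.
move=> xI ax; apply: kappar_inj.
- exact: kappa_inv_oscillating.
- exact: kappa_irrational_oscillating ax xI.1.
- by rewrite /kappar ax kappa_invP.
Qed.

Lemma kappar_irrational_pos a : oscillating a -> irrational_pos (kappar a).
Proof. by move=> aO; split; [exact: kappar_irrational|exact: kappar_gt0]. Qed.

Lemma kappa_inv_kappar a : oscillating a -> kappa_inv (kappar a) = a.
Proof.
by move=> aO; apply: kappa_invE; [exact: kappar_irrational_pos|exact: kapparE].
Qed.

Lemma kappar_kappa_inv x : irrational_pos x -> kappar (kappa_inv x) = x.
Proof. by move=> xI; rewrite /kappar kappa_invP. Qed.

End Coding.

(** * Orbits of the integral Moebius maps *)

Section Orbits.
Context {R : realType}.
Implicit Types (u v w : Rhat R) (x y : R) (a b c d : int).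

(** [pnum u] and [pden u] are homogeneous coordinates of [u]. *)
Definition pnum u : R := if u is Some x then x else 1.
Definition pden u : R := if u is Some x then 1 else 0.

Definition unimodular a b c d := a * d - b * c = 1 \/ a * d - b * c = -1.

(** Proportionality of the coordinates of [v] and of the image of [u]: an
   equation without division or case distinction. *)
Definition pmaps a b c d u v : Prop :=
  pnum v * (c%:~R * pnum u + d%:~R * pden u) =
  pden v * (a%:~R * pnum u + b%:~R * pden u).

Lemma det2 (M : 'M[int]_2) : \det M = M 0 0 * M 1 1 - M 0 1 * M 1 0.
Proof.
rewrite (expand_det_row _ 0) !big_ord_recl big_ord0 addr0 /cofactor !det_mx11.
rewrite !mxE /= expr0 mul1r expr1 mulN1r mulrN.
by congr (M _ _ * M _ _ - M _ _ * M _ _); apply/val_inj.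
Qed.

Lemma mobiusP (M : 'M[int]_2) u v : \det M != 0 ->
  v = mobius M u <-> pmaps (M 0 0) (M 0 1) (M 1 0) (M 1 1) u v.
Proof.
rewrite det2 -(intr_eq0 R) rmorphB/= !rmorphM/= /pmaps /mobius.
move: (M 0 0)%:~R (M 0 1)%:~R (M 1 0)%:~R (M 1 1)%:~R => a b c d det0.
case: u v => [x|] [y|] /=; rewrite ?mulr1 ?mulr0 ?mul1r ?mul0r ?addr0.
- case: eqP => [E|/eqP E]; split=> //.
  + rewrite E mulr0 => /esym F; exfalso; move/eqP: det0; apply.
    by have -> : a * d - b * c = a * (c * x + d) - c * (a * x + b);
      [ring|rewrite E F; ring].
  + by case=> ->; rewrite divfK.
  + by move=> F; congr Some; apply: (mulIf E); rewrite divfK.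
- by case: eqP => [E|/eqP E]; split=> // /eqP; rewrite (negPf E).
- case: eqP => [E|/eqP E]; split=> //.
  + rewrite E mulr0 => /esym F; exfalso; move/eqP: det0; apply.
    by rewrite E F; ring.
  + by case=> ->; rewrite divfK.
  + by move=> F; congr Some; apply: (mulIf E); rewrite divfK.
- by case: eqP => [E|/eqP E]; split=> // /eqP; rewrite (negPf E).
Qed.

Lemma same_orbitP u v : same_orbit u v <->
  exists a b c d, unimodular a b c d /\ pmaps a b c d u v.
Proof.
split=> [[M detM /mobiusP H]|[a [b [c [d [det1 abcd]]]]]].
  exists (M 0 0), (M 0 1), (M 1 0), (M 1 1).
  rewrite /unimodular -det2; split=> //.
  by apply: H; case: detM => ->.
pose M : 'M[int]_2 := \matrix_(i, j)
  if i == 0 then if j == 0 then a else b else if j == 0 then c else d.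
have detM : \det M = 1 \/ \det M = -1 by rewrite det2 !mxE.
exists M => //; apply/mobiusP; first by case: detM => ->.
by rewrite !mxE.
Qed.

Lemma same_orbit_refl u : same_orbit u u.
Proof.
apply/same_orbitP; exists 1, 0, 0, 1; split; first by left.
by rewrite /pmaps; ring.
Qed.

Lemma same_orbit_sym u v : same_orbit u v -> same_orbit v u.
Proof.
move=> /same_orbitP[a [b [c [d [det1 H]]]]]; apply/same_orbitP.
exists d, (- b), (- c), a; split.
  by case: det1 => E; [left|right]; rewrite -E; ring.
by rewrite /pmaps in H *; rewrite !rmorphN/=; lra.
Qed.

Lemma same_orbit_trans v u w :
  same_orbit u v -> same_orbit v w -> same_orbit u w.
Proof.
move=> /same_orbitP[a [b [c [d [det1 uv]]]]].
move=> /same_orbitP[a' [b' [c' [d' [det1' vw]]]]]; apply/same_orbitP.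
exists (a' * a + b' * c), (a' * b + b' * d).
exists (c' * a + d' * c), (c' * b + d' * d).
split.
  rewrite /unimodular.
  rewrite (_ : _ - _ = (a' * d' - b' * c') * (a * d - b * c)); last by ring.
  by case: det1 => ->; case: det1' => ->; [left|right|right|left]; ring.
rewrite /pmaps in uv vw *.
(* a vector proportional to a nonzero one is a multiple of it *)
have [l lp lq] : exists2 l, a%:~R * pnum u + b%:~R * pden u = l * pnum v &
                            c%:~R * pnum u + d%:~R * pden u = l * pden v.
  case: v uv {vw} => [y|] /= uv.
    by exists (c%:~R * pnum u + d%:~R * pden u); lra.
  by exists (a%:~R * pnum u + b%:~R * pden u); lra.
rewrite !rmorphD/= !rmorphM/=.
transitivity (pnum w * (c'%:~R * (l * pnum v) + d'%:~R * (l * pden v))).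
  by rewrite -lp -lq; ring.
transitivity (pden w * (a'%:~R * (l * pnum v) + b'%:~R * (l * pden v))).
  by have := congr1 ( *%R l) vw; lra.
by rewrite -lp -lq; ring.
Qed.

(** The sign condition excludes -oo, which is its own inverse. *)
Lemma same_orbit_inve (t : \bar R) : (0 <= t)%E ->
  same_orbit (to_Rhat t) (to_Rhat t^-1%E).
Proof.
move=> t0; apply/same_orbitP; exists 0, 1, 1, 0; split; first by right.
move: t0; rewrite /pmaps; case: inveP => [_|_|//|r r0 _] /=; [ring|ring|].
by field.
Qed.

Lemma same_orbit_oppe (t : \bar R) : same_orbit (to_Rhat t) (to_Rhat (- t)%E).
Proof.
apply/same_orbitP; exists (-1), 0, 0, 1; split; first by right.
by rewrite /pmaps; case: t => [r||] /=; rewrite ?mulrN1z; ring.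
Qed.

Lemma same_orbit_add1e (t : \bar R) :
  same_orbit (to_Rhat t) (to_Rhat (1 + t)%E).
Proof.
apply/same_orbitP; exists 1, 1, 0, 1; split; first by left.
by rewrite /pmaps; case: t => [r||] /=; ring.
Qed.

Lemma same_orbit_inv x : x != 0 -> same_orbit (Some x : Rhat R) (Some x^-1).
Proof.
move=> x0; apply/same_orbitP; exists 0, 1, 1, 0; split; first by right.
by rewrite /pmaps /=; field.
Qed.

Lemma same_orbit_opp x : same_orbit (Some x : Rhat R) (Some (- x)).
Proof. exact: (same_orbit_oppe x%:E). Qed.

Lemma same_orbit_add1 x : same_orbit (Some x : Rhat R) (Some (1 + x)).
Proof. exact: (same_orbit_add1e x%:E). Qed.

Lemma same_orbit_oo_rational x :
  same_orbit (None : Rhat R) (Some x) -> rational x.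
Proof.
move=> /same_orbitP[a [b [c [d [det1]]]]].
rewrite /pmaps /= !mulr1 !mulr0 !addr0 mul1r => xc.
apply: contrapT => /irrationalP /(_ a c); rewrite mulrC => /(_ xc) c0.
by move: xc det1; rewrite /unimodular c0 mulr0 => /esym/eqP;
  rewrite intr_eq0 => /eqP ->; rewrite mul0r mulr0 subr0 => -[].
Qed.

End Orbits.

Section GL2.
Context {R : realType}.
Implicit Types (x y : R) (a b c d : int).

(** Euclid's algorithm on the first column of a unimodular matrix. *)
(** Generation of [PGL_2(Z)] by [1 / x], [- x] and [1 + x], in the form of an
   induction principle on orbits of irrationals. The proof is Euclid's
   algorithm on the first column [(a, c)]: if [c <> 0], write [a = q c + r];
   then [1 / (y - q)] is the image of [x] under a matrix with lower left entry
   [r]. *)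
Lemma unimodular_ind (E : R -> R -> Prop) :
  (forall x, irrational x -> E x x) ->
  (forall x y, irrational x -> irrational y -> E x y -> E x y^-1) ->
  (forall x y, irrational x -> irrational y -> E x y -> E x (- y)) ->
  (forall x y, irrational x -> irrational y -> E x y -> E x (1 + y)) ->
  forall x y, irrational x -> irrational y ->
    same_orbit (Some x : Rhat R) (Some y) -> E x y.
Proof.
move=> Erefl Einv Eopp Eadd1 x y xI yI /same_orbitP[a [b [c [d [det1]]]]].
rewrite /pmaps /= !mulr1 mul1r.
have EaddN x' y' (n : nat) : irrational x' -> irrational y' -> E x' y' ->
    E x' (n%:R + y').
  move=> x'I y'I xy; elim: n => [|n IHn]; first by rewrite add0r.
  rewrite -nat1r -addrA; apply: (Eadd1 _ _) => //.
  by rewrite addrC; exact: (@irrationalD _ y' n).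
have Eadd x' y' (z : int) : irrational x' -> irrational y' -> E x' y' ->
    E x' (z%:~R + y').
  move=> x'I y'I xy; case: z => n; first exact: EaddN.
  rewrite NegzE rmorphN/= -[y']opprK -opprD; apply: (Eopp _ _) => //.
    by rewrite addrC; exact: (@irrationalD _ (- y') n.+1 (irrationalN y'I)).
  by apply: EaddN => //; [exact: irrationalN|exact: Eopp].
have [n cn] := ubnP `|c|%N.
elim: n => // n IHn in a b c d y yI det1 cn *.
have [cE|c0] := eqVneq c 0.
  rewrite cE mul0r add0r => ye.
  have [aE dE] : (a = 1 \/ a = -1) /\ (d = 1 \/ d = -1).
    have : (`|a| * `|d| = 1)%N.
      rewrite -abszM; move: det1.
      by rewrite /unimodular cE mulr0 subr0 => -[] ->.
    by move=> /eqP; rewrite muln_eq1; lia.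
  have -> : y = (d * b)%:~R + (d * a)%:~R * x.
    by move: ye; rewrite !rmorphM/=; case: dE => ->; rewrite ?mulrN1z; lra.
  apply: (Eadd _ _) => //.
    by case: aE => ->; case: dE => ->; rewrite ?mulrN1 ?mulr1 ?opprK ?mulrN1z
      ?mulN1r ?mul1r//; exact: irrationalN.
  by case: aE => ->; case: dE => ->; rewrite ?mulrN1 ?mulr1 ?opprK ?mulrN1z
    ?mulN1r ?mul1r; do ?[exact: Erefl | apply: (Eopp _ _)].
move=> ye.
have [q [r aE rc]] : exists q, exists2 r, a = q * c + r & (`|r| < `|c|)%N.
  exists (a %/ c)%Z, (a %% c)%Z; first exact: divz_eq.
  by have := modz_ge0 a c0; have := ltz_mod a c0; lia.
have y1I : irrational (y - q%:~R).
  by rewrite -rmorphN; exact: irrationalD.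
have -> : y = q%:~R + (y - q%:~R)^-1^-1 by rewrite invrK addrC subrK.
apply: (Eadd _ _) => //; first by rewrite invrK.
apply: (Einv _ _) => //; first exact: irrationalV.
apply: (IHn c d r (b - q * d)).
- exact: irrationalV.
- have E1 : c * (b - q * d) - d * r = - (a * d - b * c) by rewrite aE; ring.
  by rewrite /unimodular E1; case: det1 => ->; [right|left].
- by move: cn rc; lia.
- have y1N : y - q%:~R != 0 by exact: irrational_neq0.
  apply: (mulfI y1N); rewrite mulrA divff// mul1r.
  by move: ye; rewrite aE !rmorphD/= rmorphN/= !rmorphM/=; lra.
Qed.

End GL2.

(** * The involution respects orbits *)

Section Equivariance.
Context {R : realType}.
Implicit Types (a : bstring) (x y : R).

Lemma sxor_compl a : sxor (scompl a) phi = scompl (sxor a phi).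
Proof. by apply/funext => k; rewrite /sxor /scompl addNb. Qed.

Lemma sxorK a : sxor (sxor a phi) phi = a.
Proof. by apply/funext => k; rewrite /sxor -addbA addbb addbF. Qed.

Lemma stail_sxor k a :
  stail k (sxor a phi) = if odd k then scompl (sxor (stail k a) phi)
                         else sxor (stail k a) phi.
Proof.
apply/funext => j; rewrite /stail /sxor /scompl /phi oddD.
by case: (odd k); rewrite //= -addNb addbN addNb.
Qed.

Lemma kappa_invV x : irrational_pos x -> kappa_inv x^-1 = scompl (kappa_inv x).
Proof.
move=> xI; have xO := kappa_inv_oscillating xI.
apply: kappa_invE; first exact: irrational_pos_inv.
rewrite kapparE; last exact: oscillating_compl.
by rewrite kappar_compl kappar_kappa_inv.
Qed.

Lemma irrational_pos_add1 x : irrational_pos x -> irrational_pos (1 + x).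
Proof.
by case=> xI x0; split; [rewrite addrC; exact: (@irrationalD _ x 1)|lra].
Qed.

Lemma kappa_inv_add1 x : irrational_pos x ->
  kappa_inv (1 + x) 0%N = false /\ stail 1 (kappa_inv (1 + x)) = kappa_inv x.
Proof.
move=> xI; have x1I := irrational_pos_add1 xI.
have aO := kappa_inv_oscillating x1I.
have a0 : kappa_inv (1 + x) 0%N = false.
  by rewrite -(@kappar_lt1 R)// kappar_kappa_inv//; have := xI.2; lra.
split=> //; apply/esym/kappa_invE => //.
rewrite kapparE; last exact: (oscillating_tail 1 _).1.
congr EFin; apply: (addrI 1); rewrite -kappar_tail//.
exact: kappar_kappa_inv.
Qed.

Lemma JR_pos x : irrational_pos x ->
  JR x = to_Rhat (kappa R (sxor (kappa_inv x) phi)).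
Proof. by case=> _ x0; rewrite /JR x0. Qed.

Lemma JR_opp x : irrational_pos x ->
  JR (- x) = to_Rhat (- (kappa R (sxor (kappa_inv x) phi))^-1)%E.
Proof.
move=> xI; rewrite /JR oppr_gt0 ltNge (ltW xI.2)/= invrN opprK kappa_invV//.
have -> // : sxor (scompl (kappa_inv x)) phi_star = sxor (kappa_inv x) phi.
by apply/funext => k; rewrite /sxor /scompl /phi_star /phi addbN addNb negbK.
Qed.

Lemma JR_inv x : irrational_pos x ->
  JR x^-1 = to_Rhat (kappa R (sxor (kappa_inv x) phi))^-1%E.
Proof.
move=> xI; rewrite JR_pos; last exact: irrational_pos_inv.
by rewrite kappa_invV// sxor_compl kappa_compl.
Qed.

Lemma JR_add1 x : irrational_pos x ->
  JR (1 + x) = to_Rhat (1 + (kappa R (sxor (kappa_inv x) phi))^-1)%E.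
Proof.
move=> xI; have [a0 aT] := kappa_inv_add1 xI.
rewrite JR_pos; last exact: irrational_pos_add1.
by rewrite kappa_tail ?stail_sxor /= ?aT ?kappa_compl// /sxor a0.
Qed.

Lemma irrational_sign y :
  irrational y -> irrational_pos y \/ irrational_pos (- y).
Proof.
move=> yI; have := irrational_neq0 yI; rewrite neq_lt => /orP[y0|y0].
  by right; split; [exact: irrationalN|rewrite oppr_gt0].
by left.
Qed.

Lemma JR_orbit_opp y : irrational y -> same_orbit (JR y) (JR (- y)).
Proof.
have pos x : irrational_pos x -> same_orbit (JR x) (JR (- x)).
  move=> xI; rewrite JR_pos// JR_opp//.
  apply: same_orbit_trans (same_orbit_oppe _).
  exact/same_orbit_inve/kappa_ge0.
move=> /irrational_sign[/pos//|/pos]; rewrite opprK.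
exact: same_orbit_sym.
Qed.

Lemma JR_orbit_inv y : irrational y -> same_orbit (JR y) (JR y^-1).
Proof.
have pos x : irrational_pos x -> same_orbit (JR x) (JR x^-1).
  by move=> xI; rewrite JR_inv// JR_pos//; exact/same_orbit_inve/kappa_ge0.
move=> yI; have [/pos//|/pos H] := irrational_sign yI.
apply: (same_orbit_trans (JR_orbit_opp yI)); apply: (same_orbit_trans H).
rewrite invrN; apply/same_orbit_sym/JR_orbit_opp.
exact: irrationalV.
Qed.

(** For [y < 0] the translation is rewritten through positive arguments: if
   [y < -1] then [- y = 1 + (- (1 + y))], while for [-1 < y < 0] the numbers
   [- y] and [1 + y] are the inverses of [1 + z] and [1 + 1 / z] for some [z > 0]. *)
Lemma JR_orbit_add1 y : irrational y -> same_orbit (JR y) (JR (1 + y)).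
Proof.
have pos x : irrational_pos x -> same_orbit (JR x) (JR (1 + x)).
  move=> xI; rewrite JR_add1// JR_pos//.
  apply: same_orbit_trans (same_orbit_add1e _).
  exact/same_orbit_inve/kappa_ge0.
move=> yI; have [/pos//|[xI x0]] := irrational_sign yI.
apply: (same_orbit_trans (JR_orbit_opp yI)).
have y1I : irrational (1 + y) by rewrite addrC; exact: (@irrationalD _ y 1).
have [[_ y10]|zI] := irrational_sign y1I; last first.
  have -> : - y = 1 + - (1 + y) by ring.
  apply: same_orbit_trans (same_orbit_sym (JR_orbit_opp y1I)).
  exact/same_orbit_sym/pos.
pose z := - y^-1 - 1.
have zI : irrational_pos z.
  split.
    rewrite /z -[1](mulr1z 1) -rmorphN.
    exact/irrationalD/irrationalN/irrationalV.
  have -> : z = (1 + y) / - y by rewrite /z; field; rewrite lt_eqF//; lra.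
  by rewrite divr_gt0.
have zVI := irrational_pos_inv zI.
have -> : - y = (1 + z)^-1 by rewrite /z addrC subrK invrN invrK.
have -> : 1 + y = (1 + z^-1)^-1.
  by rewrite /z; field; rewrite !lt_eqF//=; lra.
apply: (same_orbit_trans (v := JR (1 + z))).
  exact/same_orbit_sym/JR_orbit_inv/(irrational_pos_add1 zI).1.
apply: same_orbit_trans (JR_orbit_inv (irrational_pos_add1 zVI).1).
apply: (same_orbit_trans (same_orbit_sym (pos _ zI))).
exact: (same_orbit_trans (JR_orbit_inv zI.1) (pos _ zVI)).
Qed.

Lemma JR_orbit x y : irrational x -> irrational y ->
  same_orbit (Some x : Rhat R) (Some y) -> same_orbit (JR x) (JR y).
Proof.
apply: (@unimodular_ind R (fun x y => same_orbit (JR x) (JR y))) => {}x.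
- by move=> _; exact: same_orbit_refl.
- by move=> {}y _ yI xy; apply: (same_orbit_trans xy); exact: JR_orbit_inv.
- by move=> {}y _ yI xy; apply: (same_orbit_trans xy); exact: JR_orbit_opp.
- by move=> {}y _ yI xy; apply: (same_orbit_trans xy); exact: JR_orbit_add1.
Qed.

End Equivariance.

Section Noble.
Context {R : realType}.
Implicit Types (a : bstring) (x y : R).

Local Notation kappar := (@kappar R).

Lemma phi_oscillating : oscillating phi.
Proof.
move=> k b; have [E|E] := eqVneq (odd k) b; first by exists k.
by exists k.+1 => //; rewrite /phi /=; case: (odd k) b E => -[].
Qed.

(** [phi] begins with 0 and its shift is its complement, so its value is the
   positive solution of [t = 1 + 1 / t]. *)
Lemma kappar_phi : kappar phi = golden R.
Proof.
set t := kappar phi.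
have t0 : 0 < t := kappar_gt0 phi_oscillating.
have tE : t = 1 + t^-1.
  rewrite {1}/t (kappar_tail phi_oscillating)//.
  have -> : stail 1 phi = scompl phi by apply/funext.
  by rewrite kappar_compl.
have t1 : 1 < t by rewrite tE ltrDl invr_gt0.
have t2 : t ^+ 2 = t + 1 by rewrite expr2 {2}tE mulrDr mulr1 mulfV// gt_eqF.
have -> : t = (1 + Num.sqrt 5) / 2 :> R; last by [].
have -> : 5 = (2 * t - 1) ^+ 2 :> R by lra.
rewrite sqrtr_sqr gtr0_norm; last by lra.
by field.
Qed.

(** Removing a letter is one of the maps [x - 1] and [x / (1 - x)] of
   [PGL_2(Z)]. *)
Lemma kappar_orbit_tail k a : oscillating a ->
  same_orbit (Some (kappar (stail k a)) : Rhat R) (Some (kappar a)).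
Proof.
elim: k a => [|k IHk] a aO; first exact: same_orbit_refl.
have aT := (oscillating_tail 1 a).1 aO.
have {IHk} := IHk _ aT; rewrite stailD add1n => /same_orbit_trans; apply.
have [kI k0] := @kappar_irrational_pos R _ aO.
have [kTI kT0] := @kappar_irrational_pos R _ aT.
case a0: (a 0%N); last first.
  by rewrite (kappar_tail aO a0); exact: same_orbit_add1.
apply: (same_orbit_trans (same_orbit_inv (irrational_neq0 kTI))).
apply: (same_orbit_trans (same_orbit_add1 _)).
rewrite -kappar_tail_true//; apply/same_orbit_sym/same_orbit_inv.
exact: irrational_neq0.
Qed.

(** If [a (+) phi] is eventually constant then [a] ends in [phi] or in its
   complement. *)
Lemma not_noble_sxor_phi a : oscillating a -> ~ noble (kappar a) ->
  oscillating (sxor a phi).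
Proof.
move=> aO; apply: contra_notP => /Noscillating[k [b ab]].
have aT : stail k a = if b (+) odd k then scompl phi else phi.
  apply/funext => j; have := ab (k + j)%N (leq_addr _ _).
  rewrite /sxor /stail /phi oddD => /(canRL (addbK _)) ->.
  by rewrite addbA; case: (b (+) odd k) => //=.
rewrite /noble; apply: same_orbit_trans (kappar_orbit_tail k aO).
rewrite aT -kappar_phi; case: ifP => _; last exact: same_orbit_refl.
rewrite kappar_compl; apply: same_orbit_inv.
by rewrite gt_eqF// kappar_gt0//; exact: phi_oscillating.
Qed.

(** The golden section is sent to [oo], so a noble value would make
   [J (kappa (a (+) phi)) = kappa a] rational. *)
Lemma not_noble_kappar_sxor a : oscillating a -> oscillating (sxor a phi) ->
  ~ noble (kappar (sxor a phi)).
Proof.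
move=> aO bO; rewrite /noble -kappar_phi.
have phiI := @kappar_irrational_pos R _ phi_oscillating.
have bI := @kappar_irrational_pos R _ bO.
move=> /(JR_orbit phiI.1 bI.1).
rewrite !JR_pos// !kappa_inv_kappar//; last first.
  exact: phi_oscillating.
rewrite sxorK (kapparE aO).
have -> : kappa R (sxor phi phi) = +oo%E.
  apply: cvg_conv_kappa; apply: cvg_near_cst; exists 0%N => // -[//|m] _.
  by rewrite convS run_length_None// => k; rewrite /sxor addbb.
move=> /same_orbit_oo_rational.
exact: kappar_irrational aO.
Qed.

End Noble.

(** * Quadratic forms and Lagrange's theorem *)

Section Forms.
Context {R : realType}.
Implicit Types (x y : R) (F : int * int * int) (b : bool).

Definition root_of F x : Prop :=
  F.1.1%:~R * x ^+ 2 + F.1.2%:~R * x + F.2%:~R = 0.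

Definition disc F : int := F.1.2 ^+ 2 - 4 * F.1.1 * F.2.

Lemma root_of_irrational A B C x : irrational x -> root_of (A, B, C) x ->
  A = 0 -> B = 0 /\ C = 0.
Proof.
move=> /irrationalP xI; rewrite /root_of /= => + A0.
rewrite A0 mul0r add0r => E.
have B0 : B = 0 by apply: (xI (- C)); rewrite rmorphN/=; lra.
by split=> //; apply/eqP; rewrite -(intr_eq0 R) -E B0 mul0r add0r.
Qed.

Lemma quadratic_irrational_orbit x y : irrational x -> irrational y ->
  same_orbit (Some x : Rhat R) (Some y) ->
  quadratic_irrational x -> quadratic_irrational y.
Proof.
apply: (@unimodular_ind R
  (fun x y => quadratic_irrational x -> quadratic_irrational y)) => //.
- move=> {}x {}y _ yI IH /IH[_ [A [B [C [A0 E]]]]]; split.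
    exact: irrationalV.
  have y0 := irrational_neq0 yI.
  exists C, B, A; split.
    apply: contra_neq A0 => C0.
    move/irrationalP: yI => /(_ (- B) A); apply.
    move: E; rewrite C0 addr0 rmorphN/= => E; apply: (mulIf y0).
    by lra.
  have -> : C%:~R * y^-1 ^+ 2 + B%:~R * y^-1 + A%:~R =
     (A%:~R * y ^+ 2 + B%:~R * y + C%:~R) / y ^+ 2 by field.
  by rewrite E mul0r.
- move=> {}x {}y _ yI IH /IH[_ [A [B [C [A0 E]]]]]; split.
    exact: irrationalN.
  exists A, (- B), C; split=> //; rewrite -E rmorphN/=; ring.
- move=> {}x {}y _ yI IH /IH[_ [A [B [C [A0 E]]]]]; split.
    by rewrite addrC; exact: (@irrationalD _ y 1).
  exists A, (B - 2 * A), (A - B + C); split=> //; rewrite -E.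
  by rewrite !(rmorphB, rmorphD, rmorphM)/=; ring.
Qed.

(** The inverses of the two maps [t / (1 + t)] and [1 + t] that prefix a letter;
   [form_step] substitutes these maps in a form [(A, B, C)], that is,
   [A X^2 + B X Y + C Y^2]. *)
Definition down b x : R := if b then x / (1 - x) else x - 1.

Definition form_step b F : int * int * int :=
  let: (A, B, C) := F in
  if b then (A + B + C, B + 2 * C, C) else (A, 2 * A + B, A + B + C).

Lemma disc_step b F : disc (form_step b F) = disc F.
Proof. by case: F => [[A B] C]; case: b; rewrite /disc /=; ring. Qed.

Lemma sub1_neq0 x : irrational x -> 1 - x != 0.
Proof.
by move=> xI; rewrite subr_eq0 eq_sym; exact: (irrational_int 1 xI).
Qed.

Lemma root_of_step b F x : irrational x -> root_of F x ->
  root_of (form_step b F) (down b x).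
Proof.
move=> /sub1_neq0 x1; case: F => [[A B] C]; rewrite /root_of /= => E.
case: b => /=; rewrite !(rmorphD, rmorphM)/=; last by rewrite -E; ring.
transitivity ((A%:~R * x ^+ 2 + B%:~R * x + C%:~R) / (1 - x) ^+ 2).
  by field.
by rewrite E mul0r.
Qed.

Lemma irrational_down b x : irrational x -> irrational (down b x).
Proof.
move=> xI; have x1 := sub1_neq0 xI; case: b => /=.
  apply: (@irrational_mobius _ 1 0 (-1) 1 x) => //.
  by rewrite mulN1r [- x + 1]addrC divfK// mul1r addr0.
by have := @irrationalD _ x (-1) xI; rewrite mulrN1z.
Qed.

Lemma vieta A B C x y : x != y -> root_of (A, B, C) x -> root_of (A, B, C) y ->
  C%:~R = A%:~R * (x * y).
Proof.
rewrite /root_of /= -subr_eq0 => xy rx ry.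
have S : A%:~R * (x + y) + B%:~R = 0 by apply: (mulfI xy); rewrite mulr0; lra.
by have := congr1 ( *%R x) S; lra.
Qed.

(** A second positive root would make [A C = A^2 x y] nonnegative. *)
Lemma pos_root_unique A B C x y : A * C < 0 -> 0 < x -> 0 < y ->
  root_of (A, B, C) x -> root_of (A, B, C) y -> x = y.
Proof.
rewrite -(ltrz0 R) rmorphM/= => AC x0 y0 rx ry; apply/eqP.
apply: contraLR AC => xy; rewrite (vieta xy rx ry) -leNgt mulrA.
by rewrite mulr_ge0// ?sqr_ge0// mulr_ge0 ?ltW.
Qed.

(** Roots of opposite signs give [A C < 0], so that the discriminant
   [B^2 - 4 A C = B^2 + 4 |A| |C|] bounds all the coefficients. *)
Lemma reduced_form A B C x y : irrational x -> irrational y ->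
  root_of (A, B, C) x -> root_of (A, B, C) y ->
  0 < x -> y < 0 -> disc (A, B, C) != 0 ->
  A * C < 0 /\ [/\ `|A| <= disc (A, B, C), `|B| <= disc (A, B, C) &
                   `|C| <= disc (A, B, C)].
Proof.
move=> xI yI rx ry x0 y0 D0.
have A0 : A != 0.
  apply: contra_neq D0 => A0; have [B0 C0] := root_of_irrational xI rx A0.
  by rewrite /disc /= A0 B0 C0.
have AC : A * C < 0.
  rewrite -(ltrz0 R) rmorphM/=; have A0' : A%:~R != 0 :> R by rewrite intr_eq0.
  have xy : x != y by rewrite gt_eqF//; lra.
  rewrite (vieta xy rx ry).
  rewrite mulrA -expr2; have := pmulr_rlt0 (x * y) (_ : 0 < A%:~R ^+ 2).
  move=> -> //; last by rewrite exprn_even_gt0.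
  by rewrite pmulr_rlt0.
split=> //; rewrite /disc /=.
have C0 : C != 0 by apply: contraTneq AC => ->; rewrite mulr0 ltxx.
have nAC : - (A * C) = `|A| * `|C| by rewrite -normrM ltr0_norm.
have nA : 1 <= `|A| by lia.
have nC : 1 <= `|C| by lia.
have B2 : `|B| <= B ^+ 2 by rewrite -(real_normK (num_real B)) expr2; nia.
have B20 : 0 <= B ^+ 2 by exact: sqr_ge0.
have -> : B ^+ 2 - 4 * A * C = B ^+ 2 + 4 * (`|A| * `|C|) by rewrite -nAC; ring.
move: `|A| `|C| `|B| nA nC B2 B20 => a c b'; move: (B ^+ 2) => s.
by split; nia.
Qed.

Lemma bounded_triples_repeat (F : nat -> int * int * int) (D : int) :
  (forall i, [/\ `|(F i).1.1| <= D, `|(F i).1.2| <= D & `|(F i).2| <= D]) ->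
  exists i j, (i < j)%N /\ F i = F j.
Proof.
move=> FD; pose M := (absz D + absz D)%N.
pose e (z : int) : 'I_M.+1 := inord (absz (z + (absz D)%:Z)).
have e_inj (z z' : int) : `|z| <= D -> `|z'| <= D -> e z = e z' -> z = z'.
  move=> zD z'D /(congr1 (@nat_of_ord _)); rewrite !inordK; rewrite /M; lia.
pose G i := (e (F i).1.1, e (F i).1.2, e (F i).2).
pose T : finType := ('I_M.+1 * 'I_M.+1 * 'I_M.+1)%type.
have /injectivePn[i [j ij Gij]] : ~~ injectiveb (fun i : 'I_#|T|.+1 => G i).
  by apply/negP => /injectiveP/leq_card; rewrite card_ord ltnn.
have FE : F i = F j.
  have [a1 a2 a3] := FD i; have [b1 b2 b3] := FD j.
  move: Gij => [/e_inj E1 /e_inj E2 /e_inj E3].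
  by move: E1 E2 E3 a1 a2 a3 b1 b2 b3; case: (F i) => [[? ?] ?];
    case: (F j) => [[? ?] ?] /= E1 E2 E3 *; rewrite E1// E2// E3.
have [ltij|ltji|E] := ltngtP i j.
- by exists i, j.
- by exists j, i.
- by move: ij; rewrite (val_inj E) eqxx.
Qed.

End Forms.

Section Lagrange.
Context {R : realType}.
Implicit Types (x y : R) (a : bstring).

(** The slow algorithm applied to [x] with the choices dictated by [a]; applied
   to a conjugate root with [a] the code of the other one, it keeps both roots
   on the same form. *)
Fixpoint follow a x k : R :=
  if k is k'.+1 then down (a k') (follow a x k') else x.

Fixpoint form_at a (F : int * int * int) k : int * int * int :=
  if k is k'.+1 then form_step (a k') (form_at a F k') else F.

Lemma follow_bits x k : follow (bits x) x k = iter k slow x.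
Proof. by elim: k => //= k ->. Qed.

Lemma follow_irrational a x k : irrational x -> irrational (follow a x k).
Proof. by move=> xI; elim: k => //= k; exact: irrational_down. Qed.

Lemma follow_root a F x k : irrational x -> root_of F x ->
  root_of (form_at a F k) (follow a x k).
Proof.
move=> xI Fx; elim: k => //= k IHk; apply: root_of_step => //.
exact: follow_irrational.
Qed.

Lemma disc_form_at a F k : disc (form_at a F k) = disc F.
Proof. by elim: k => //= k <-; rewrite disc_step. Qed.

(** As long as [y] stays positive it must make the same choices as [x], for the
   wrong choice makes it negative; always agreeing would give [y] the code of
   [x]. Once negative, it stays so. *)
Lemma follow_eventually_neg x y : irrational_pos x -> irrational y -> x != y ->
  exists K, forall k, (K <= k)%N -> follow (bits x) y k < 0.
Proof.
move=> xI yI xy.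
have [[K yK]|yN] := pselect (exists k, follow (bits x) y k < 0).
  exists K => k; elim: k => [|k IHk]; first by rewrite leqn0 => /eqP <-.
  rewrite leq_eqVlt => /orP[/eqP <- //|]; rewrite ltnS => /IHk /=.
  move: (follow _ _ _) => z z0; case: (bits x k) => /=; last by lra.
  by rewrite pmulr_llt0// invr_gt0; lra.
exfalso; move/eqP: xy; apply.
have y_pos k : 0 < follow (bits x) y k.
  rewrite lt_neqAle eq_sym leNgt.
  rewrite (irrational_neq0 (@follow_irrational (bits x) y k yI))/=.
  by apply/negP => yk; apply: yN; exists k.
have bit k : bits x k = (follow (bits x) y k < 1).
  have := y_pos k.+1; have := y_pos k => /=.
  have := irrational_int 1 (@follow_irrational (bits x) y k yI).
  move: (follow _ _ _) => z; case: (bits x k) => /= z1 z0.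
    rewrite pmulr_rgt0// invr_gt0; lra.
  by case: ltP; lra.
have E k : follow (bits x) y k = iter k slow y.
  by elim: k => //= k <-; rewrite bit.
have bxy : bits x = bits y by apply/funext => k; rewrite bit E.
have yI' : irrational_pos y by split=> //; exact: (y_pos 0%N).
by have := kappa_bits xI; rewrite bxy kappa_bits// => -[].
Qed.

(** Lagrange's theorem. The forms met along the expansion have the same
   discriminant, and bounded coefficients once the conjugate is negative; so
   one of them comes back, and with it its only positive root. *)
Lemma quadratic_bits_periodic x : 0 < x -> quadratic_irrational x ->
  exists k P, (0 < P)%N /\ stail (k + P) (bits x) = stail k (bits x).
Proof.
move=> x0 [xI [A [B [C [A0 rx]]]]].
have xIP : irrational_pos x by [].
have A0' : A%:~R != 0 :> R by rewrite intr_eq0.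
(* the conjugate root *)
pose y := - (B%:~R / A%:~R) - x.
have yI : irrational y.
  apply: (@irrational_mobius _ (- A) (- B) 0 A x) => //.
    by rewrite mulr0 subr0 mulNr oppr_eq0 mulf_neq0.
  by rewrite /y !rmorphN/=; field.
have ry : root_of (A, B, C) y.
  rewrite /root_of /= -rx /y; field; exact: A0'.
have xy : x != y.
  apply/eqP => xy; have /irrationalP/(_ (- B) (2 * A)) := xI.
  have -> : (2 * A)%:~R * x = (- B)%:~R.
    rewrite mulrC rmorphM rmorphN/=.
    rewrite [LHS](_ : _ = A%:~R * (x + x)); last by ring.
    by rewrite {2}xy /y; field.
  by move=> /(_ erefl)/eqP; rewrite mulf_eq0 (negPf A0).
have D0 : disc (A, B, C) != 0.
  rewrite -(intr_eq0 R) /disc /= rmorphB rmorphXn !rmorphM/=.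
  have -> : C%:~R = A%:~R * (x * y).
    by move: rx => /eqP; rewrite /y addrC addr_eq0 => /eqP ->; field.
  have -> : B%:~R = - (A%:~R * (x + y)) by rewrite /y; field.
  rewrite [X in X != _](_ : _ = (A%:~R * (x - y)) ^+ 2); last by ring.
  by rewrite expf_neq0// mulf_neq0// subr_eq0.
have [K yneg] := follow_eventually_neg xIP yI xy.
pose F i := form_at (bits x) (A, B, C) (K + i).
have xi i := irrational_pos_iter (K + i) xIP.
have rxi i : root_of (F i) (iter (K + i) slow x).
  by rewrite -follow_bits; exact: follow_root.
have reduced i : (F i).1.1 * (F i).2 < 0 /\
    [/\ `|(F i).1.1| <= disc (A, B, C), `|(F i).1.2| <= disc (A, B, C) &
        `|(F i).2| <= disc (A, B, C)].
  have := rxi i; have := follow_root (bits x) (K + i) yI ry.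
  rewrite -(disc_form_at (bits x) (A, B, C) (K + i)) -/(F i).
  have : disc (F i) != 0 by rewrite disc_form_at.
  case: (F i) => -[A' B'] C' DF ry' rx'.
  apply: (reduced_form (xi i).1 _ rx' ry' (xi i).2 _ DF).
  - exact: follow_irrational.
  - by apply: yneg; exact: leq_addr.
have [i [j [ij Fij]]] := bounded_triples_repeat (fun i => (reduced i).2).
exists (K + i)%N, (j - i)%N; split; first by lia.
rewrite -addnA subnKC 1?ltnW// !stail_bits; congr bits.
have := rxi j; have := rxi i; have := (reduced i).1; rewrite -Fij.
case: (F i) => -[A' B'] C' AC ri rj.
exact: (pos_root_unique AC (xi j).2 (xi i).2 rj ri).
Qed.

End Lagrange.

(** * Periodic strings and the involution *)

Section Euler.
Context {R : realType}.
Implicit Types (a : bstring) (x y : R).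

Local Notation kappar := (@kappar R).

(** The prefix of length [n] acts as a matrix [p, q; r, s] of natural numbers.
   The bound [n <= q + r] ensures that it is not scalar, so that a fixed point
   satisfies a nontrivial quadratic equation. *)
Lemma kappar_prefix a n : oscillating a -> exists p q r s : nat,
  [/\ (0 < p)%N, (0 < s)%N, (n <= q + r)%N &
      kappar a * (r%:R * kappar (stail n a) + s%:R) =
      p%:R * kappar (stail n a) + q%:R].
Proof.
move=> aO; elim: n => [|n [p [q [r [s [p0 s0 nqr E]]]]]].
  by exists 1%N, 0%N, 0%N, 1%N; split => //; rewrite stail0; ring.
have nO := (oscillating_tail n a).1 aO.
have nSO := (oscillating_tail 1 _).1 nO.
have k0 := @kappar_gt0 R _ nSO.
have -> : stail n.+1 a = stail 1 (stail n a) by rewrite stailD addn1.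
case n0: (stail n a 0%N).
  exists (p + q)%N, q, (r + s)%N, s; split; [lia..|].
  have kE : kappar (stail n a) * (1 + kappar (stail 1 (stail n a))) =
            kappar (stail 1 (stail n a)).
    rewrite -[kappar (stail n a)]invrK (kappar_tail_true nO n0).
    by field; rewrite !gt_eqF//; lra.
  move: E kE; move: (kappar (stail n a)) (kappar (stail 1 _)) (kappar a).
  move=> z t k E kE.
  have := congr1 ( *%R (1 + t)) E; rewrite !natrD.
  have -> : (1 + t) * (k * (r%:R * z + s%:R)) =
    k * (r%:R * (z * (1 + t)) + s%:R * (1 + t)) by ring.
  have -> : (1 + t) * (p%:R * z + q%:R) = p%:R * (z * (1 + t)) + q%:R * (1 + t).
    by ring.
  by rewrite kE; lra.
exists p, (p + q)%N, r, (r + s)%N; split; [lia..|].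
by move: E; rewrite (kappar_tail nO n0) !natrD; lra.
Qed.

Lemma periodic_quadratic a P : oscillating a -> (0 < P)%N -> stail P a = a ->
  quadratic_irrational (kappar a).
Proof.
move=> aO P0 aP; have kI := @kappar_irrational R _ aO; split=> //.
have [p [q [r [s [p0 s0 Pqr]]]]] := kappar_prefix P aO; rewrite aP => E.
have rE : r%:Z%:~R * kappar a ^+ 2 + (s%:Z - p%:Z)%:~R * kappar a +
    (- q%:Z)%:~R = 0.
  have nz (n : nat) : n%:Z%:~R = n%:R :> R by [].
  by rewrite rmorphN rmorphB/= !nz; lra.
exists r, (s%:Z - p%:Z), (- q%:Z); split=> //.
apply/eqP => r0; have [_ q0] := root_of_irrational kI rE r0; lia.
Qed.

Lemma kappar_quadratic a k P : oscillating a -> (0 < P)%N ->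
  stail (k + P) a = stail k a -> quadratic_irrational (kappar a).
Proof.
move=> aO P0 aP; have kO := (oscillating_tail k a).1 aO.
have := @periodic_quadratic (stail k a) P kO P0; rewrite stailD => /(_ aP).
apply: quadratic_irrational_orbit; [exact: kappar_irrational..|].
exact: kappar_orbit_tail.
Qed.

(** The period is doubled to make it even, hence also a period of [phi]. *)
Lemma sxor_phi_periodic a k P : stail (k + P) a = stail k a ->
  stail (k + (P + P)) (sxor a phi) = stail k (sxor a phi).
Proof.
move=> aP; rewrite !stail_sxor !oddD addbb addbF.
suff -> : stail (k + (P + P)) a = stail k a by [].
by rewrite addnA -stailD aP stailD.
Qed.

End Euler.

Section Involution.
Context {R : realType}.
Implicit Types (x y : R).

Lemma Qset_orbit x y : irrational y -> same_orbit (Some x : Rhat R) (Some y) ->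
  Qset x -> Qset y.
Proof.
move=> yI xy [xQ xN]; split.
  exact: quadratic_irrational_orbit xQ.1 yI xy xQ.
apply: contra_not xN => yN.
exact: same_orbit_trans yN (same_orbit_sym xy).
Qed.

Lemma Qset_pos x : Qset x -> 0 < x ->
  let a := kappa_inv x in
  oscillating (sxor a phi) /\ Qset (kappar (R := R) (sxor a phi)).
Proof.
move=> [xQ xN] x0 a; have xI : irrational_pos x by split => //; exact: xQ.1.
have aO : oscillating a := kappa_inv_oscillating xI.
have kx : kappar (R := R) a = x := kappar_kappa_inv xI.
have bO : oscillating (sxor a phi).
  by apply: (@not_noble_sxor_phi R) => //; rewrite kx.
split=> //; split; last exact: not_noble_kappar_sxor.
have [k [P [P0 aP]]] := quadratic_bits_periodic x0 xQ.
have ab : a = bits x by apply: kappa_invE => //; exact: kappa_bits.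
apply: (@kappar_quadratic _ _ k (P + P)) => //; first by lia.
by apply: sxor_phi_periodic; rewrite ab.
Qed.

Lemma JR_involution x : Qset x ->
  exists y : R, [/\ JR x = Some y, Qset y & JR y = Some x].
Proof.
move=> xQ; have xI := xQ.1.1.
case: (irrational_sign xI) => zI.
  have [bO bQ] := Qset_pos xQ zI.2.
  have bI := @kappar_irrational_pos R _ bO.
  exists (kappar (sxor (kappa_inv x) phi)).
  by rewrite !JR_pos// kappa_inv_kappar// sxorK kappa_invP// kapparE.
set z := - x in zI; have -> : x = - z by rewrite opprK.
have zQ : Qset z by apply: Qset_orbit zI.1 _ xQ; exact: same_orbit_opp.
have [bO bQ] := Qset_pos zQ zI.2; set b := sxor _ _ in bO bQ.
have bI := @kappar_irrational_pos R _ bO.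
have bVI := irrational_pos_inv bI.
exists (- (kappar b)^-1); split.
- rewrite JR_opp// -kappa_compl kapparE ?kappar_compl//.
  exact: oscillating_compl.
- apply: Qset_orbit bQ; first exact/irrationalN/bVI.1.
  apply: same_orbit_trans (same_orbit_opp _).
  exact/same_orbit_inv/irrational_neq0/bI.1.
- rewrite JR_opp// kappa_invV// sxor_compl kappa_compl inveK.
  by rewrite kappa_inv_kappar// sxorK kappa_invP.
Qed.

End Involution.

Theorem theorem14 (R : realType) :
  (forall x : R, Qset x ->
     exists y : R, [/\ JR x = Some y, Qset y & JR y = Some x]) /\
  (forall x y : R, Qset x -> Qset y ->
     same_orbit (Some x : Rhat R) (Some y) -> same_orbit (JR x) (JR y)).
Proof.
split=> [x|x y [[xI _] _] [[yI _] _]]; first exact: JR_involution.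
exact: JR_orbit.
Qed.
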